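(* Let $4/3<p<4$ and let $\varsigma\ge 1$ be a constant such that $\|S_nf\|_p\le\varsigma\|f\|_p$ for all $f\in L_p[0,1]$ and all $n\in\mathbb{N}$, where $S_nf$ is the $n$-th partial sum of the Fourier-Legendre series of $f$ on $[0,1]$. Then for all $f\in L_p[0,1]$ and all $n\in\mathbb{N}$ (with $n\ge1$) $$K(f,n^{-1})_p\le(1+2\varsigma)\,\|M_nf-f\|_p.$$
   Context: $\|\cdot\|_p$ is the standard $L_p$-norm on $[0,1]$ (Lebesgue measure). $S_nf:=\sum_{\ell=0}^n\mathcal{P}_\ell f$, where $\mathcal{P}_\ell$ is the orthogonal projection (with respect to $\langle f,g\rangle=\int_0^1 f(x)g(x)\,dx$, extended to $L_p[0,1]$ by the same integral formula) onto the span of the Legendre polynomial of degree $\ell$ on $[0,1]$. By a theorem of Pollard, for each $4/3<p<4$ a constant $\varsigma\ge1$ as in the claim exists. $M_n$ is the univariate unweighted Bernstein-Durrmeyer operator $$M_nf(x):=\sum_{k=0}^n p_{n,k}(x)\left(\int_0^1p_{n,k}(y)\,dy\right)^{-1}\int_0^1f(y)p_{n,k}(y)\,dy,\qquad p_{n,k}(x):=\binom{n}{k}x^k(1-x)^{n-k}.$$ The $K$-functional is, for $t>0$, $$K(f,t)_p:=\inf_{g\in C^2[0,1]}\left\{\|f-g\|_p+t\,\|P(D)g\|_p\right\},\qquad P(D)g(x):=\frac{d}{dx}\left(x(1-x)\,\frac{dg}{dx}(x)\right).$$ *)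

(* Defs.v *)
From HB Require Import structures.
From mathcomp Require Import all_boot all_order all_algebra.
From mathcomp Require Import all_classical all_reals all_analysis.

Set Implicit Arguments.
Unset Strict Implicit.
Unset Printing Implicit Defensive.

Import Order.TTheory GRing.Theory Num.Theory.
Import numFieldNormedType.Exports.

Local Open Scope classical_set_scope.
Local Open Scope ring_scope.

(* A function on [0,1] is represented by a function R -> R of which only the
   values on [0,1] matter: L_p[0,1] and its norm are those of the extension by
   zero to R, and its elements are functions rather than a.e.-classes. *)

Definition Lp01_norm {R : realType} (p : R) (f : R -> R) : \bar R :=
  'N[lebesgue_measure]_(p%:E)[EFin \o (f \_ `[0, 1])].

Definition Lp01 {R : realType} (p : R) : set (R -> R) :=
  [set f | f \_ `[0, 1] \in Lfun lebesgue_measure p%:E].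

Definition inner01 {R : realType} (f g : R -> R) : R :=
  \int[lebesgue_measure]_(x in `[0, 1]) (f x * g x).

(* Rodrigues' formula for [0,1]: p^`N(l) is the l-th derivative of p divided
   by l!. *)
Definition legendre01 {R : realType} (l : nat) : {poly R} :=
  (('X^2 - 'X) ^+ l)^`N(l).

Definition legendre_proj {R : realType} (l : nat) (f : R -> R) : R -> R :=
  let L := horner (legendre01 l) in
  fun x => inner01 f L / inner01 L L * L x.

Definition legendre_sum {R : realType} (n : nat) (f : R -> R) : R -> R :=
  fun x => \sum_(l < n.+1) legendre_proj l f x.

Definition bernstein {R : realType} (n k : nat) (x : R) : R :=
  'C(n, k)%:R * x ^+ k * (1 - x) ^+ (n - k).

Definition bernstein_durrmeyer {R : realType} (n : nat) (f : R -> R) : R -> R :=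
  fun x => \sum_(k < n.+1)
    bernstein n k x
    * (\int[lebesgue_measure]_(y in `[0, 1]) bernstein n k y)^-1
    * \int[lebesgue_measure]_(y in `[0, 1]) (f y * bernstein n k y).

(* Differentiation on the interval [0,1], hence one-sided at 0 and at 1 and
   independent of the values outside [0,1].  Only meaningful at the points of
   [0,1]. *)
Definition quot01 {R : realType} (f : R -> R) (x y : R) : R :=
  (f y - f x) / (y - x).

Definition derivable01 {R : realType} (f : R -> R) (x : R) : Prop :=
  cvg (quot01 f x y @[y --> within `[0, 1] x^']).

Definition D01 {R : realType} (f : R -> R) (x : R) : R :=
  lim (quot01 f x y @[y --> within `[0, 1] x^']).

Definition C2_01 {R : realType} : set (R -> R) :=
  [set g | [/\ forall x : R, x \in `[0, 1] -> derivable01 g x,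
               forall x : R, x \in `[0, 1] -> derivable01 (D01 g) x &
               {within `[0, 1], continuous (D01 (D01 g))}]].

Definition PD {R : realType} (g : R -> R) : R -> R :=
  D01 (fun x => x * (1 - x) * D01 g x).

Definition K_functional {R : realType} (p : R) (f : R -> R) (t : R) : \bar R :=
  ereal_inf [set (Lp01_norm p (f \- g)%R + t%:E * Lp01_norm p (PD g))%E
            | g in C2_01].

(* Main.v *)
From HB Require Import structures.
Require Import Defs.
From mathcomp Require Import all_boot all_order all_algebra.
From mathcomp Require Import all_classical all_reals all_analysis.
From mathcomp Require Import measurable_realfun ftc probability.
From mathcomp Require Import ring lra zify.

Set Implicit Arguments.
Unset Strict Implicit.
Unset Printing Implicit Defensive.

Import Order.TTheory GRing.Theory Num.Theory.
Import numFieldNormedType.Exports.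

Local Open Scope classical_set_scope.
Local Open Scope ring_scope.

(** Write S_l for the l-th Legendre partial sum and P_l for the l-th Legendre
    projection.  The operator M_n is diagonal in the Legendre basis: P_l M_n f
    equals lam_l P_l f with lam_0 = 1, and M_n f is a polynomial of degree at
    most n.  The differential operator P(D) is diagonal too, with eigenvalues
    -l(l+1).  With h = M_n f - f, so that P_l h = (lam_l - 1) P_l f, this gives

      P(D) M_n f = sum over 1 <= l <= n of c_l P_l h,
      where c_l = l(l+1) lam_l / (1 - lam_l).

    Since P_0 h = 0 and c_(n+1) = 0, Abel summation turns the right-hand side
    into the sum of the (c_m - c_(m+1)) S_m h over 1 <= m <= n.  The c_l
    decrease ([PD_multiplier_decreasing]) and c_1 = n, so these coefficients
    are nonnegative with sum n ([PD_multiplier_telescope]), whence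
    |P(D) M_n f| <= n s |h|.  Taking g = M_n f in the K-functional bounds it by
    |h| + (1/n) n s |h| = (1 + s) |h|, which is at most (1 + 2s) |h|.

    Monotonicity of the c_l comes from the recurrence
    (n+l+2) lam_(l+1) = (n-l) lam_l, which shows by induction on l that
    (n-l)(1 - lam_l) <= l(l+1) ([durrmeyer_eigenvalue_deficit]); this
    yields c_(l+1) <= c_l.

    Both diagonalizations are instances of one principle ([legendre_eigen]): a
    symmetric operator on polynomials that does not raise degrees maps the l-th
    Legendre polynomial to a multiple of itself, and the factor is read off the
    coefficient of degree l.  For M_n the image of a monomial follows from the
    beta integral and the factorial moments of the binomial weights.  Functions
    f in L_p enter only through the linear functional v |-> <f, v> on
    polynomials, and the adjunction <M_n f, v> = <f, M_n v>
    ([durrmeyer_adjoint]) reduces everything to polynomials. *)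

(** * Generalities on factorials, sums and polynomials *)

Lemma natr_fact_neq0 (R : numDomainType) l : l`!%:R != 0 :> R.
Proof. by rewrite pnatr_eq0 -lt0n fact_gt0. Qed.

Lemma derivn_lead (R : nzRingType) (u : {poly R}) l :
  (size u <= l.+1)%N -> u^`(l) = (u`_l *+ l`!)%:P.
Proof.
move=> ul; apply/polyP => -[|i]; rewrite coef_derivn coefC /=.
  by rewrite addn0 ffactnn.
by rewrite nth_default ?mul0rn // (leq_trans ul) // addnS ltnS leq_addr.
Qed.

Lemma derivn_exp_root (R : comNzRingType) (q r : {poly R}) x k m :
  (k < m)%N -> root q x -> ((q ^+ m * r)^`(k)).[x] = 0.
Proof.
move=> km qx0.
elim: k m r km => [|k IH] [|m] // r km.
  by rewrite derivn0 exprS !hornerM (rootP qx0) !mul0r.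
have -> : (q ^+ m.+1 * r)^`(k.+1) =
    (m.+1%:R *: (q ^+ m * (q^`() * r)) + q ^+ m.+1 * r^`())^`(k).
  by rewrite derivSn derivM deriv_exp -scaler_nat -scalerAl -mulrA
    [q^`() * (_ * _)]mulrCA.
by rewrite derivnD derivnZ hornerD hornerZ !IH ?mulr0 ?addr0 // ltnW.
Qed.

(** Only the partial sums of positive index appear on the right: the operator
    norms of the Legendre sums are assumed bounded for these indices only. *)
Lemma abel_summation (R : pzRingType) (V : lmodType R) (c : nat -> R)
    (v : nat -> V) n :
    v 0%N = 0 ->
  \sum_(l < n.+1) c l *: v l =
  \sum_(m < n) (c m.+1 - c m.+2) *: (\sum_(l < m.+2) v l)
  + c n.+1 *: \sum_(l < n.+1) v l.
Proof.
move=> v0; elim: n => [|n IH].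
  by rewrite !big_ord_recr !big_ord0 /= v0 !add0r !scaler0.
rewrite big_ord_recr IH /= [in RHS]big_ord_recr /= -!addrA; congr (_ + _).
rewrite -scalerDl subrK.
by rewrite [in RHS]big_ord_recr /= scalerDr.
Qed.

(** * Integrals of polynomials over the unit interval *)

Section Moments.
Context {R : realType}.
Implicit Types (f : R -> R) (u v : {poly R}).
Local Notation mu := (@lebesgue_measure R).
Local Notation I01 := (`[0, 1]%classic : set R).

(** The only way in which a function of L_p is ever seen by M_n or by the
    Legendre projections. *)
Definition moment f u : R := inner01 f (horner u).
Definition int01 u : R := moment (fun=> 1) u.

Lemma within_continuous_horner (A : set R) u : {within A, continuous (horner u)}.
Proof. by apply: continuous_subspaceT => x; exact: continuous_horner. Qed.

Lemma measurable_horner (A : set R) u : measurable A -> measurable_fun A (horner u).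
Proof.
move=> mA; apply: subspace_continuous_measurable_fun => //.
exact: within_continuous_horner.
Qed.

Lemma bounded_horner u : [bounded u.[x] | x in I01].
Proof.
have /compact_bounded[M [_ mrt]] :=
  continuous_compact (@within_continuous_horner I01 u) (@segment_compact _ _ _).
by exists M; split; rewrite ?num_real // => ? ? ? ?; exact: mrt.
Qed.

Lemma integrable_horner u : mu.-integrable I01 (EFin \o horner u).
Proof.
apply: continuous_compact_integrable; first exact: segment_compact.
exact: within_continuous_horner.
Qed.

Lemma integrable_cst01 : mu.-integrable I01 (EFin \o (fun=> 1)).
Proof.
apply: eq_integrable (integrable_horner 1) => // x _.
by rewrite /= hornerC.
Qed.

Lemma integrable_moment f u : mu.-integrable I01 (EFin \o f) ->
  mu.-integrable I01 (EFin \o (fun x => f x * u.[x])).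
Proof.
move=> fi; apply: (integrableMl _ fi) => //.
- exact: measurable_horner.
- exact: bounded_horner.
Qed.

Lemma moment_is_scalar f : mu.-integrable I01 (EFin \o f) -> scalar (moment f).
Proof.
move=> fi a u v; rewrite /moment /inner01.
rewrite -RintegralZl//; last exact: integrable_moment.
rewrite -RintegralD//; last 2 first.
- rewrite (_ : EFin \o _ = fun x => (a%:E * (f x * u.[x])%R%:E)%E) //.
  by apply: integrableZl => //; exact: integrable_moment.
- exact: integrable_moment.
by apply: eq_Rintegral => x _; rewrite hornerE hornerZ; ring.
Qed.

HB.instance Definition _ :=
  GRing.isLinear.Build R {poly R} R *%R int01 (moment_is_scalar integrable_cst01).

Lemma moment_horner u v : moment (horner u) v = int01 (u * v).
Proof.
by apply: eq_Rintegral => x _; rewrite hornerM mul1r.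
Qed.

Lemma int01E u : int01 u = \int[mu]_(x in I01) u.[x].
Proof. by apply: eq_Rintegral => x _; rewrite mul1r. Qed.

Lemma int01_deriv u : int01 u^`() = u.[1] - u.[0].
Proof.
rewrite int01E /Rintegral (@continuous_FTC2 _ _ (horner u))//.
- exact: within_continuous_horner.
- split.
  + by move=> x _; exact: derivable_horner.
  + exact/cvg_at_right_filter/continuous_horner.
  + exact/cvg_at_left_filter/continuous_horner.
- by move=> x _; rewrite derivE.
Qed.

Lemma int01_by_parts u v :
  int01 (u^`() * v) = u.[1] * v.[1] - u.[0] * v.[0] - int01 (u * v^`()).
Proof.
have := int01_deriv (u * v); rewrite derivM raddfD/= !hornerM => <-.
by rewrite addrK.
Qed.

Lemma int01_beta a b :
  int01 ('X^a * (1 - 'X) ^+ b) = (a`! * b`!)%:R / (a + b).+1`!%:R.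
Proof.
rewrite -beta_fun_fact int01E /beta_fun -Rintegral_mkcond.
by apply: eq_Rintegral => x _; rewrite !(hornerE, horner_exp).
Qed.

End Moments.

(** * Legendre polynomials *)

Section Legendre.
Context {R : realType}.
Implicit Types (u v r : {poly R}).
Local Notation L := (@legendre01 R).

Local Notation q01 := ('X^2 - 'X : {poly R}).

(** Integrating by parts m times: the boundary terms vanish because every
    derivative of order below m still has 0 and 1 as roots.  The cofactor r
    makes the induction go through, as it absorbs one factor X^2 - X at each
    step. *)
Lemma int01_rodrigues m r v :
  int01 ((q01 ^+ m * r)^`(m) * v) = (-1) ^+ m * int01 (q01 ^+ m * r * v^`(m)).
Proof.
elim: m r v => [|m IH] r v; first by rewrite !derivn0 !expr0 !mul1r.
rewrite derivnS int01_by_parts !derivn_exp_root //; last 2 first.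
- by rewrite rootE !(hornerE, hornerXn) expr0n subrr.
- by rewrite rootE !(hornerE, hornerXn) expr1n subrr.
rewrite !mul0r subr0 sub0r exprSr -!mulrA IH derivSn [(-1) ^+ m.+1]exprS.
by rewrite mulN1r mulNr -!mulrA.
Qed.

Lemma size_q01 : size q01 = 3%N.
Proof. by rewrite size_polyDl ?size_polyXn ?size_polyN ?size_polyX. Qed.

Lemma monic_q01 : q01 \is monic.
Proof.
by rewrite monicE lead_coefDl ?lead_coefXn ?size_polyXn ?size_polyN ?size_polyX.
Qed.

Lemma size_q01X l : size (q01 ^+ l) = (l.*2).+1.
Proof.
have mq := monic_exp l monic_q01.
by rewrite -[LHS]prednK ?size_exp ?size_q01 ?mul2n// lt0n size_poly_eq0 monic_neq0.
Qed.

Lemma coef_q01X_lead l : (q01 ^+ l)`_(l.*2) = 1.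
Proof.
have /monicP := monic_exp l monic_q01.
by rewrite lead_coefE size_q01X.
Qed.

Lemma coef_legendre l : (L l)`_l = 'C(l.*2, l)%:R.
Proof. by rewrite /L coef_nderivn addnn coef_q01X_lead. Qed.

Lemma coef_legendre_neq0 l : (L l)`_l != 0.
Proof. by rewrite coef_legendre pnatr_eq0 -lt0n bin_gt0 -addnn leq_addr. Qed.

Lemma size_legendre l : (size (L l) <= l.+1)%N.
Proof.
apply/leq_sizeP => j lj; rewrite /L coef_nderivn nth_default ?mul0rn//.
by rewrite size_q01X -addnn -addnS leq_add2l.
Qed.

Lemma int01_legendreM l v :
  l`!%:R * int01 (L l * v) = (-1) ^+ l * int01 (q01 ^+ l * v^`(l)).
Proof.
have := int01_rodrigues l 1 v; rewrite !mulr1 => <-.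
by rewrite nderivn_def -[_^`N(l) *+ _]scaler_nat -scalerAl linearZ.
Qed.

Lemma legendre_orth l v : (size v <= l)%N -> int01 (L l * v) = 0.
Proof.
move=> vl; apply: (mulfI (natr_fact_neq0 R l)).
by rewrite int01_legendreM derivn_poly0 // mulr0 linear0 !mulr0.
Qed.

(** After the integrations by parts, the l-th derivative of the l-th Legendre
    polynomial is a nonzero constant, so that the norm is a nonzero multiple of
    the beta integral of (X (1 - X))^l. *)
Lemma legendre_norm_neq0 l : int01 (L l * L l) != 0.
Proof.
suff : l`!%:R * int01 (L l * L l) != 0 by rewrite mulf_eq0 negb_or => /andP[].
rewrite int01_legendreM derivn_lead ?size_legendre //.
rewrite mulf_neq0 ?signr_eq0 //.
rewrite -[_%:P]alg_polyC -scalerAr mulr1 linearZ /= mulf_neq0//.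
  by rewrite mulrn_eq0 negb_or -lt0n fact_gt0 coef_legendre_neq0.
have -> : q01 ^+ l = (-1) ^+ l *: ('X^l * (1 - 'X) ^+ l).
  rewrite -exprMn -[RHS]mul_polyC polyC_exp -exprMn polyCN; congr (_ ^+ _).
  by rewrite polyC1; ring.
rewrite linearZ /= mulf_neq0 ?signr_eq0 // int01_beta mulf_neq0 ?invr_neq0 //;
  by rewrite pnatr_eq0 -lt0n ?muln_gt0 ?fact_gt0.
Qed.

Lemma legendre_expansion n u : (size u <= n)%N ->
  u = \sum_(l < n) (int01 (u * L l) / int01 (L l * L l)) *: L l.
Proof.
elim: n u => [|n IH] u un.
  by rewrite big_ord0; apply/eqP; rewrite -size_poly_leq0.
pose c := u`_n / (L n)`_n.
have wn : (size (u - c *: L n)%R <= n)%N.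
  apply/leq_sizeP => j; rewrite leq_eqVlt => /predU1P[<-|nj].
    by rewrite coefB coefZ mulfVK ?subrr// coef_legendre_neq0.
  rewrite coefB coefZ !nth_default ?mulr0 ?subrr //.
    by rewrite (leq_trans (size_legendre n)).
  by rewrite (leq_trans un).
have uE : u = (u - c *: L n) + c *: L n by rewrite subrK.
rewrite big_ord_recr /= {1}uE; congr (_ + _).
  rewrite {1}(IH _ wn); apply: eq_bigr => l _; congr (_ *: _); congr (_ / _).
  rewrite mulrBl raddfB /= -scalerAl linearZ /= legendre_orth ?mulr0 ?subr0 //.
  by rewrite (leq_trans (size_legendre l)).
congr (_ *: _); rewrite uE mulrDl raddfD /= [_ * L n]mulrC (legendre_orth wn).
by rewrite add0r -scalerAl linearZ /= mulfK // legendre_norm_neq0.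
Qed.

(** For j < l, the j-th Legendre coefficient of T (L l) is a multiple of
    <T (L l), L j> = <L l, T (L j)>, which vanishes because T (L j) has degree
    at most j.  Only the coefficient on L l itself remains. *)
Lemma legendre_eigen (T : {poly R} -> {poly R}) (e : nat -> R) :
    linear T ->
    (forall u v, int01 (T u * v) = int01 (u * T v)) ->
    (forall l, size (T 'X^l) <= l.+1)%N ->
    (forall l, (T 'X^l)`_l = e l) ->
  forall l, T (L l) = e l *: L l.
Proof.
move=> Tlin Tsym Tsize Tcoef l.
pose TL : {linear {poly R} -> {poly R}} :=
  HB.pack T (GRing.isLinear.Build _ _ _ _ T Tlin).
have TE u k : (size u <= k)%N -> T u = \sum_(i < k) u`_i *: T 'X^i.
  move=> uk; have {1}-> : u = \sum_(i < k) u`_i *: 'X^i.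
    rewrite -poly_def; apply/polyP => i; rewrite coef_poly.
    by case: ltnP => // ki; rewrite nth_default // (leq_trans uk).
  by rewrite -[T]/(TL : _ -> _) linear_sum; apply: eq_bigr => i _; rewrite linearZ.
have Tsz u k : (size u <= k)%N -> (size (T u) <= k)%N.
  move=> uk; rewrite (TE u k uk) (leq_trans (size_sum _ _ _)) //.
  apply/bigmax_leqP => i _; rewrite (leq_trans (size_scale_leq _ _)) //.
  exact: leq_trans (Tsize i) (ltn_ord i).
have Tlead u k : (size u <= k.+1)%N -> (T u)`_k = e k * u`_k.
  move=> uk; rewrite (TE u k.+1 uk) coef_sum big_ord_recr /= coefZ Tcoef mulrC.
  rewrite big1 ?add0r // => i _; rewrite coefZ [X in _ * X]nth_default ?mulr0 //.
  exact: leq_trans (Tsize i) (ltn_ord i).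
have := legendre_expansion (Tsz _ _ (size_legendre l)).
rewrite big_ord_recr /= big1 ?add0r => [|i _]; last first.
  have Ti : (size (T (L i)) <= l)%N.
    exact: leq_trans (Tsz _ _ (size_legendre i)) (ltn_ord i).
  by rewrite Tsym (legendre_orth Ti) mul0r scale0r.
set c := _ / _ => TLE; rewrite TLE; congr (_ *: _).
apply: (mulIf (coef_legendre_neq0 l)).
by rewrite -(Tlead _ _ (size_legendre l)) TLE coefZ.
Qed.

End Legendre.

(** * The Bernstein-Durrmeyer operator and P(D) on polynomials *)

Section Durrmeyer.
Context {R : realType}.
Implicit Types (u v : {poly R}).
Local Notation L := (@legendre01 R).

Definition bernstein_poly n k : {poly R} :=
  'C(n, k)%:R *: ('X^k * (1 - 'X) ^+ (n - k)).

Lemma horner_bernstein_poly n k x : (bernstein_poly n k).[x] = bernstein n k x.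
Proof. by rewrite !(hornerE, horner_exp). Qed.

Lemma size_bernstein_poly n k : (k <= n)%N ->
  (size (bernstein_poly n k) <= n.+1)%N.
Proof.
move=> kn; rewrite (leq_trans (size_scale_leq _ _)) //.
rewrite (leq_trans (size_polyMleq _ _)) // size_polyXn /=.
have s1 : (size (1 - 'X : {poly R})%R <= 2)%N.
  by rewrite (leq_trans (size_polyD _ _)) // size_polyN size_polyX size_poly1.
have := size_poly_exp_leq (1 - 'X : {poly R}) (n - k).
move: (size _) s1 => a; move: (size _) => b; nia.
Qed.

Lemma int01_XnM_bernstein n k l : (k <= n)%N ->
  int01 ('X^l * bernstein_poly n k) =
    n`!%:R * (k + l)`!%:R / (k`!%:R * (n + l).+1`!%:R).
Proof.
move=> kn; rewrite -scalerAr linearZ /= mulrA -exprD int01_beta -(bin_fact kn).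
have -> : (l + k + (n - k) = n + l)%N by lia.
rewrite [(l + k)%N]addnC.
have := natr_fact_neq0 R k; have := natr_fact_neq0 R (n + l).+1.
(* field would unfold the factorial of a successor, hence the abstraction *)
move: (n + l).+1`! => F F0 k0.
by rewrite !natrM; field; apply/andP.
Qed.

Lemma int01_bernstein n k : (k <= n)%N -> int01 (bernstein_poly n k) = n.+1%:R^-1.
Proof.
move=> kn; have := int01_XnM_bernstein 0 kn; rewrite mul1r !addn0 factS natrM => ->.
have := natr_fact_neq0 R k; have := natr_fact_neq0 R n => n0 k0.
by field; rewrite nat1r pnatr_eq0 n0 k0.
Qed.

(** The j-th factorial moment of the binomial law, divided by j!: cancelling
    C(k, j) against C(n, k) leaves C(n, j) X^j times a full binomial expansion
    of ((1 - X) + X)^(n - j). *)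
Lemma bernstein_factorial_moment n j :
  \sum_(k < n.+1) 'C(k, j)%:R *: bernstein_poly n k = 'C(n, j)%:R *: 'X^j.
Proof.
have [nj|jn] := ltnP n j.
  rewrite bin_small // scale0r big1 // => k _; rewrite bin_small ?scale0r //.
  exact: leq_trans (ltn_ord k) nj.
(* the terms of index below j vanish; the others are shifted by j *)
rewrite -(big_mkord xpredT (fun k => 'C(k, j)%:R *: bernstein_poly n k)).
rewrite (big_cat_nat (n := j)) //=; last exact: leqW.
rewrite big_nat_cond big1 ?add0r => [|k]; last first.
  by rewrite andbT => kj; rewrite bin_small ?scale0r.
rewrite -{1}[j]add0n big_addn subSn // big_mkord.
have -> : 'X^j = 'X^j * ((1 - 'X) + 'X) ^+ (n - j) :> {poly R}.
  by rewrite subrK expr1n mulr1.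
rewrite exprDn mulr_sumr scaler_sumr; apply: eq_bigr => k _.
have kn : (k <= n - j)%N by rewrite -ltnS.
have trinomial : ('C(k + j, j) * 'C(n, k + j) = 'C(n, j) * 'C(n - j, k))%N.
  apply/eqP; rewrite -(eqn_pmul2r (fact_gt0 k)) -(eqn_pmul2r (fact_gt0 j)).
  rewrite -(eqn_pmul2r (fact_gt0 (n - j - k))); apply/eqP.
  have := @bin_fact (k + j) j (leq_addl _ _).
  have kjn : (k + j <= n)%N by lia.
  have := bin_fact kjn; have := bin_fact jn; have := bin_fact kn.
  rewrite addnK; have -> : (n - (k + j) = n - j - k)%N by lia.
  move=> h1 h2 h3 h4.
  transitivity n`!; first by rewrite -h3 -h4; ring.
  by rewrite -h2 -h1; ring.
rewrite /bernstein_poly scalerA -natrM trinomial natrM -scalerA; congr (_ *: _).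
rewrite mulrnAr scaler_nat; congr (_ *+ _).
have -> : (n - (k + j) = n - j - k)%N by lia.
by rewrite exprD; ring.
Qed.

(** M_n as a function of the functional v |-> <f, v> alone, so that functions
    of L_p and polynomials are treated at once. *)
Definition durrmeyer_poly n (phi : {poly R} -> R) : {poly R} :=
  \sum_(k < n.+1)
    (phi (bernstein_poly n k) / int01 (bernstein_poly n k)) *: bernstein_poly n k.

Lemma size_durrmeyer_poly n phi : (size (durrmeyer_poly n phi) <= n.+1)%N.
Proof.
rewrite (leq_trans (size_sum _ _ _)) //; apply/bigmax_leqP => k _.
by rewrite (leq_trans (size_scale_leq _ _)) // size_bernstein_poly // -ltnS.
Qed.

Definition durrmeyer_op n u := durrmeyer_poly n (fun v => int01 (u * v)).

(** The kernel of M_n is symmetric in its two variables. *)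
Lemma durrmeyer_adjoint n phi v : scalar phi ->
  int01 (durrmeyer_poly n phi * v) = phi (durrmeyer_op n v).
Proof.
move=> lphi; pose Phi : {scalar {poly R}} :=
  HB.pack phi (GRing.isLinear.Build _ _ _ _ phi lphi).
have phi_sum (F : 'I_n.+1 -> {poly R}) : phi (\sum_k F k) = \sum_k phi (F k).
  exact: (linear_sum Phi).
have phiZ a w : phi (a *: w) = a * phi w by exact: (linearZ_LR Phi).
rewrite /durrmeyer_op /durrmeyer_poly mulr_suml linear_sum phi_sum.
apply: eq_bigr => k _.
by rewrite -scalerAl linearZ /= (phiZ (_ / _)) [v * _]mulrC; ring.
Qed.

Lemma durrmeyer_op_sym n u v :
  int01 (durrmeyer_op n u * v) = int01 (u * durrmeyer_op n v).
Proof.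
rewrite durrmeyer_adjoint // => a w1 w2.
by rewrite mulrDr -scalerAr linearP.
Qed.

Lemma durrmeyer_op_is_linear n : linear (durrmeyer_op n).
Proof.
move=> a u v; rewrite /durrmeyer_op /durrmeyer_poly scaler_sumr -big_split.
apply: eq_bigr => k _ /=.
have -> : int01 ((a *: u + v) * bernstein_poly n k) =
    a * int01 (u * bernstein_poly n k) + int01 (v * bernstein_poly n k).
  by rewrite mulrDl -scalerAl linearP.
by rewrite mulrDl scalerDl -mulrA -scalerA.
Qed.

Definition durrmeyer_eigenvalue n l : R :=
  (n.+1`! * l`! * 'C(n, l))%:R / (n + l).+1`!%:R.

(** The beta integral gives the moments of X^l against the Bernstein basis,
    proportional to C(k + l, l); Vandermonde's identity writes these numbers in
    terms of the C(k, j), whose Bernstein sums are monomials. *)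
Lemma durrmeyer_op_Xn n l : durrmeyer_op n 'X^l =
  \sum_(j < l.+1)
    (n.+1`!%:R * l`!%:R / (n + l).+1`!%:R * ('C(l, l - j)%:R * 'C(n, j)%:R))
    *: 'X^j.
Proof.
transitivity ((n.+1`!%:R * l`!%:R / (n + l).+1`!%:R) *:
    \sum_(k < n.+1) ('C(k + l, l))%:R *: bernstein_poly n k).
  rewrite scaler_sumr; apply: eq_bigr => k _; rewrite [RHS]scalerA; congr (_ *: _).
  have kn : (k <= n)%N by rewrite -ltnS.
  rewrite int01_XnM_bernstein // int01_bernstein // invrK.
  have := @bin_fact (k + l) l (leq_addl _ _); rewrite addnK => <-.
  have := natr_fact_neq0 R k; have := natr_fact_neq0 R (n + l).+1.
  move: (n + l).+1`! => F F0 k0.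
  by rewrite factS !natrM; field; apply/andP.
transitivity ((n.+1`!%:R * l`!%:R / (n + l).+1`!%:R) *:
    \sum_(k < n.+1) \sum_(j < l.+1)
      'C(l, l - j)%:R *: ('C(k, j)%:R *: bernstein_poly n k)).
  congr (_ *: _); apply: eq_bigr => k _.
  rewrite -binomial.Vandermonde natr_sum scaler_suml; apply: eq_bigr => j _.
  by rewrite scalerA natrM mulrC.
rewrite exchange_big scaler_sumr; apply: eq_bigr => j _ /=.
by rewrite -scaler_sumr bernstein_factorial_moment !scalerA.
Qed.

Lemma durrmeyer_op_legendre n l :
  durrmeyer_op n (L l) = durrmeyer_eigenvalue n l *: L l.
Proof.
apply: legendre_eigen l.
- exact: durrmeyer_op_is_linear.
- exact: durrmeyer_op_sym.
- move=> l; rewrite durrmeyer_op_Xn (leq_trans (size_sum _ _ _)) //.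
  apply/bigmax_leqP => j _; rewrite (leq_trans (size_scale_leq _ _)) //.
  by rewrite size_polyXn.
- move=> l; rewrite durrmeyer_op_Xn coef_sum big_ord_recr /= coefZ coefXn.
  rewrite eqxx mulr1.
  rewrite big1 ?add0r => [|j _]; last first.
    by rewrite coefZ coefXn gtn_eqF ?mulr0.
  by rewrite subnn bin0 mul1r /durrmeyer_eigenvalue !natrM; ring.
Qed.

Definition PD_poly u : {poly R} := ('X * (1 - 'X) * u^`())^`().

Lemma PD_poly_is_linear : linear PD_poly.
Proof.
by move=> a u v; rewrite /PD_poly derivD derivZ mulrDr derivD -scalerAr derivZ.
Qed.

Lemma PD_poly_sym u v : int01 (PD_poly u * v) = int01 (u * PD_poly v).
Proof.
rewrite [u * _]mulrC !int01_by_parts !hornerE /= !(subrr, mulr0, mul0r).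
by congr (_ - int01 _); ring.
Qed.

Lemma PD_poly_Xn l :
  PD_poly 'X^l = (l ^ 2)%:R *: 'X^(l.-1) - (l * l.+1)%:R *: 'X^l.
Proof.
case: l => [|l].
  by rewrite /PD_poly expr0 derivC mulr0 deriv0 !scale0r subrr.
rewrite /PD_poly derivXn /=.
have -> : 'X * (1 - 'X) * ('X^l *+ l.+1) =
    ('X^(l.+1) - 'X^(l.+2)) *+ l.+1 :> {poly R}.
  by rewrite mulrnAr; congr (_ *+ _); rewrite !exprS; ring.
rewrite derivMn derivB !derivXn /= !scaler_nat mulrnBl -!mulrnA.
by rewrite mulnn [(l.+2 * _)%N]mulnC.
Qed.

Lemma PD_poly_legendre l : PD_poly (L l) = - (l * l.+1)%:R *: L l.
Proof.
apply: (legendre_eigen (e := fun l => - (l * l.+1)%:R)) l.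
- exact: PD_poly_is_linear.
- exact: PD_poly_sym.
- move=> l; rewrite PD_poly_Xn (leq_trans (size_polyD _ _)) // size_polyN geq_max.
  rewrite !(leq_trans (size_scale_leq _ _)) // size_polyXn //.
  by case: l.
- move=> l; rewrite PD_poly_Xn coefB !coefZ !coefXn eqxx mulr1.
  case: l => [|l]; first by rewrite exp0n // mul0r sub0r.
  by rewrite gtn_eqF //= mulr0 sub0r.
Qed.

End Durrmeyer.

(** * Eigenvalues and multipliers *)

Section Eigenvalues.
Context {R : realType}.
Local Notation lam n l := (durrmeyer_eigenvalue n l : R).

Lemma durrmeyer_eigenvalue0 n : lam n 0 = 1.
Proof.
by rewrite /durrmeyer_eigenvalue bin0 fact0 !muln1 addn0 divff // natr_fact_neq0.
Qed.

Lemma durrmeyer_eigenvalueS n l :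
  (n + l + 2)%:R * lam n l.+1 = (n - l)%:R * lam n l.
Proof.
rewrite /durrmeyer_eigenvalue [(n + l.+1)%N]addnS [(n + l).+2`!]factS addn2.
have -> : (n.+1`! * l.+1`! * 'C(n, l.+1) =
           n.+1`! * l`! * 'C(n, l) * (n - l))%N.
  rewrite [l.+1`!]factS; move: (n.+1`!) => c.
  transitivity (c * l`! * (l.+1 * 'C(n, l.+1)))%N; first by ring.
  by rewrite mul_bin_left; ring.
have := natr_fact_neq0 R (n + l).+1.
move: (n + l).+1`! (n + l).+2 (ltn0Sn (n + l).+1) n.+1`! => F m m0 N F0.
rewrite !natrM; field.
by rewrite F0 pnatr_eq0 -lt0n.
Qed.

Lemma durrmeyer_eigenvalue_bounds n l : 0 <= lam n l <= 1.
Proof.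
elim: l => [|l /andP[l0 l1]]; first by rewrite durrmeyer_eigenvalue0 ler01 lexx.
have p0 : 0 < (n + l + 2)%:R :> R by rewrite ltr0n addn2.
apply/andP; split.
  by rewrite -(pmulr_rge0 _ p0) durrmeyer_eigenvalueS mulr_ge0.
rewrite -(ler_pM2l p0) durrmeyer_eigenvalueS mulr1.
apply: le_trans (_ : (n - l)%:R * 1 <= _); first exact: ler_wpM2l.
by rewrite mulr1 ler_nat; lia.
Qed.

Lemma durrmeyer_eigenvalue_lt1 n l : (0 < n)%N -> (0 < l)%N -> lam n l < 1.
Proof.
case: l => // l n0 _; have p0 : 0 < (n + l + 2)%:R :> R by rewrite ltr0n addn2.
rewrite -(ltr_pM2l p0) durrmeyer_eigenvalueS mulr1.
have /andP[l0 l1] := durrmeyer_eigenvalue_bounds n l.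
apply: le_lt_trans (_ : (n - l)%:R * 1 < _); first exact: ler_wpM2l.
by rewrite mulr1 ltr_nat; lia.
Qed.

(** By the recurrence, 1 - lam_l grows by lam_l (2l + 2) / (n + l + 2) at each
    step; since lam_l <= 1 the left-hand side grows by at most 2(l + 1), which
    is the increment of the right-hand side. *)
Lemma durrmeyer_eigenvalue_deficit n l : (l <= n)%N ->
  (n%:R - l%:R) * (1 - lam n l) <= l%:R * (l%:R + 1).
Proof.
elim: l => [|l IH] ln; first by rewrite durrmeyer_eigenvalue0 subrr mulr0 mul0r.
have /andP[l0 l1] := durrmeyer_eigenvalue_bounds n l.
have := durrmeyer_eigenvalueS n l; move: (IH (ltnW ln)).
rewrite natrB 1?ltnW // !natrD -[l.+1%:R]natr1.
have : l%:R + 1 <= n%:R :> R by rewrite natr1 ler_nat.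
have : 0 <= l%:R :> R by rewrite ler0n.
move: (l%:R : R) (n%:R : R) (lam n l) (lam n l.+1) l0 l1.
move=> y x a b a0 a1 y0 yx H E.
(* clearing the denominator n + l + 2 of the recurrence *)
have d0 : 0 < x + y + 2 by lra.
rewrite -(ler_pM2l d0).
have h1 := ler_wpM2l (ltW d0) H.
have h2 : 0 <= (x + y + 2) * (1 - a) by rewrite mulr_ge0; lra.
have h3 : (x - y - 1) * a <= (x - y - 1) * 1 by rewrite ler_wpM2l; lra.
have h4 : 0 <= (y + 1) * ((x + y + 2) - (x - y - 1) * a) by rewrite mulr_ge0; lra.
have E' := congr1 (fun t => (x - y - 1) * t) E.
rewrite /= in E'; lra.
Qed.

(** The factor that P(D) M_n f carries relatively to M_n f - f on the l-th
    Legendre component, for l > 0. *)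
Definition PD_multiplier n l : R := l%:R * (l%:R + 1) * lam n l / (1 - lam n l).

Lemma PD_multiplier1 n : (0 < n)%N -> PD_multiplier n 1 = n%:R.
Proof.
move=> n0; have := durrmeyer_eigenvalueS n 0.
rewrite durrmeyer_eigenvalue0 subn0 addn0 mulr1 /PD_multiplier.
have := durrmeyer_eigenvalue_lt1 n0 (ltn0Sn 0).
move: (lam n 1) => a a1 E.
have d0 : 1 - a != 0 by rewrite subr_eq0 gt_eqF.
apply: (mulIf d0); rewrite mulfVK //.
move: E; rewrite natrD => E; lra.
Qed.

Lemma PD_multiplier_large n : PD_multiplier n n.+1 = 0.
Proof.
by rewrite /PD_multiplier /durrmeyer_eigenvalue bin_small // muln0 mul0r mulr0 mul0r.
Qed.

(** Once lam_(l+1) is eliminated by the recurrence, the inequality is the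
    bound of [durrmeyer_eigenvalue_deficit] multiplied by 2 lam_l. *)
Lemma PD_multiplier_decreasing n l : (0 < l <= n)%N ->
  PD_multiplier n l.+1 <= PD_multiplier n l.
Proof.
case/andP=> l0 ln; have n0 := leq_trans l0 ln.
have := durrmeyer_eigenvalue_lt1 n0 l0.
have := durrmeyer_eigenvalue_lt1 n0 (ltn0Sn l).
have /andP[a0 _] := durrmeyer_eigenvalue_bounds n l.
have := durrmeyer_eigenvalueS n l; have := durrmeyer_eigenvalue_deficit ln.
rewrite /PD_multiplier.
rewrite natrB // !natrD -[l.+1%:R]natr1.
have : 0 <= l%:R :> R by rewrite ler0n.
have : 0 <= n%:R :> R by rewrite ler0n.
move: (l%:R : R) (n%:R : R) (lam n l) (lam n l.+1) a0.
move=> y x a b a0 x0 y0 H E b1 a1.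
rewrite ler_pdivrMr ?subr_gt0 // [X in _ <= X]mulrAC ler_pdivlMr ?subr_gt0 //.
have d0 : 0 < x + y + 2 by lra.
suff core : (y + 2) * b * (1 - a) <= y * a * (1 - b).
  have y1 : 0 <= y + 1 by lra.
  have := ler_wpM2l y1 core; lra.
rewrite -(ler_pM2l d0).
have h1 := ler_wpM2l a0 H.
have E1 := congr1 (fun t => (y + 2) * (1 - a) * t) E.
have E2 := congr1 (fun t => y * a * t) E.
rewrite /= in E1 E2; lra.
Qed.

End Eigenvalues.

(** * P(D) of a Bernstein-Durrmeyer polynomial *)

Section Diagonalization.
Context {R : realType}.
Local Notation L := (@legendre01 R).

Definition legendre_coef (phi : {poly R} -> R) l : R :=
  phi (L l) / int01 (L l * L l).

(** Here psi is the functional of M_n f - f when phi is that of f, so that the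
    inner sums on the right are the Legendre sums of M_n f - f. *)
Lemma PD_poly_durrmeyer n (phi : {poly R} -> R) : (0 < n)%N -> scalar phi ->
  let psi v := int01 (durrmeyer_poly n phi * v) - phi v in
  PD_poly (durrmeyer_poly n phi) =
  \sum_(m < n) (PD_multiplier n m.+1 - PD_multiplier n m.+2) *:
     \sum_(l < m.+2) legendre_coef psi l *: L l.
Proof.
move=> n0 lphi psi.
have ev l :
    int01 (durrmeyer_poly n phi * L l) = durrmeyer_eigenvalue n l * phi (L l).
  rewrite durrmeyer_adjoint // durrmeyer_op_legendre.
  pose Phi : {scalar {poly R}} :=
    HB.pack phi (GRing.isLinear.Build _ _ _ _ phi lphi).
  exact: (linearZ_LR Phi).
have psi0 : psi (L 0) = 0 by rewrite /psi ev durrmeyer_eigenvalue0 mul1r subrr.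
transitivity (\sum_(l < n.+1) PD_multiplier n l *: (legendre_coef psi l *: L l)).
  rewrite {1}(legendre_expansion (size_durrmeyer_poly n phi)).
  pose PL : {linear {poly R} -> {poly R}} :=
    HB.pack (@PD_poly R)
      (GRing.isLinear.Build _ _ _ _ (@PD_poly R) (@PD_poly_is_linear R)).
  rewrite -[@PD_poly R]/(PL : _ -> _) linear_sum; apply: eq_bigr => l _.
  rewrite linearZ /= PD_poly_legendre !scalerA; congr (_ *: _).
  rewrite ev /legendre_coef; case: (val l) => [|k].
    (* at l = 0 both sides vanish, as M_n preserves the mean *)
    by rewrite psi0 mul0r mulr0 mul0n oppr0 mulr0.
  rewrite /psi ev /PD_multiplier natrM -natr1.
  have := @durrmeyer_eigenvalue_lt1 R _ _ n0 (ltn0Sn k).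
  move: (durrmeyer_eigenvalue _ _) (@legendre_norm_neq0 R k.+1) => a N0 a1.
  by field; rewrite N0 subr_eq0 gt_eqF.
rewrite (@abel_summation _ _ (PD_multiplier n)
  (fun l => legendre_coef psi l *: L l)).
  by rewrite PD_multiplier_large scale0r addr0.
by rewrite /legendre_coef psi0 mul0r scale0r.
Qed.

Lemma PD_multiplier_telescope n : (0 < n)%N ->
  \sum_(m < n) (PD_multiplier n m.+1 - PD_multiplier n m.+2) = n%:R :> R.
Proof.
move=> n0.
rewrite -(big_mkord xpredT (fun m => PD_multiplier n m.+1 - PD_multiplier n m.+2)).
under eq_bigr do rewrite -opprB.
rewrite sumrN (telescope_sumr (fun m => PD_multiplier n m.+1)) //.
rewrite PD_multiplier_large PD_multiplier1 //.
by rewrite sub0r opprK.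
Qed.

End Diagonalization.

(** * One-sided derivatives of polynomials on the unit interval *)

Section Derivatives.
Context {R : realType}.
Implicit Types (u : {poly R}) (f g : R -> R).
Local Notation I01 := (`[0, 1]%classic : set R).

(** The difference quotient of u at x is itself a polynomial, namely the
    quotient of u - u(x) by X - x, whose value at x is u'(x).  The function f
    is only required to agree with u on [0,1], since iterated one-sided
    derivatives are controlled there only. *)
Lemma quot01_horner_cvg f u x : x \in I01 -> {in I01, f =1 horner u} ->
  quot01 f x y @[y --> within I01 x^'] --> u^`().[x].
Proof.
move=> xI fu.
have /factor_theorem [v vE] : root (u - u.[x]%:P) x.
  by rewrite rootE !hornerE subrr.
have -> : u^`().[x] = v.[x].
  have := congr1 (fun w : {poly R} => w^`().[x]) vE.
  by rewrite derivB derivC subr0 derivM derivXsubC !hornerE subrr mulr0 add0r.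
apply: (@cvg_trans _ (horner v @ within I01 x^')).
  have nx : within I01 x^' (fun y => y != x).
    exact: (@filterE _ (nbhs x) _ (fun y => y != x -> I01 y -> y != x)
      (fun y yx _ => yx)).
  apply: near_eq_cvg; near=> y.
  have yI : I01 y by near: y; exact: withinT.
  have yx : y != x by near: y; exact: nx.
  have := congr1 (fun w : {poly R} => w.[y]) vE.
  rewrite !hornerE /quot01 fu ?inE // fu // => ->.
  by rewrite mulfK // subr_eq0.
apply: cvg_trans (@continuous_horner _ v x).
by apply: cvg_app; apply: cvg_trans (@nbhs_dnbhs _ x); exact: cvg_within.
Unshelve. all: by end_near. Qed.

(** Needed for limits along this filter to be unique. *)
Lemma within01_proper x : x \in I01 -> ProperFilter (within I01 x^').
Proof.
rewrite inE /= in_itv /= => /andP[x0 x1]; split; last exact: within_filter.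
move=> /nbhs_ballP[e /= e0 xe].
have [xlt|xge] := ltP x 1.
- have m0 : 0 < Num.min (e / 2) (1 - x) by rewrite lt_min; apply/andP; split; lra.
  have m1 : Num.min (e / 2) (1 - x) <= e / 2 by rewrite ge_min lexx.
  have m2 : Num.min (e / 2) (1 - x) <= 1 - x by rewrite ge_min lexx orbT.
  apply: (xe (x + Num.min (e / 2) (1 - x))).
  + by rewrite /ball /= opprD addrA subrr sub0r normrN gtr0_norm //; lra.
  + by apply/eqP; lra.
  + by rewrite /= in_itv /=; apply/andP; split; lra.
- have m0 : 0 < Num.min (e / 2) 1 by rewrite lt_min; apply/andP; split; lra.
  have m1 : Num.min (e / 2) 1 <= e / 2 by rewrite ge_min lexx.
  have m2 : Num.min (e / 2) 1 <= 1 by rewrite ge_min lexx orbT.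
  apply: (xe (x - Num.min (e / 2) 1)).
  + by rewrite /ball /= opprB addrC subrK gtr0_norm //; lra.
  + by apply/eqP; lra.
  + by rewrite /= in_itv /=; apply/andP; split; lra.
Qed.

Lemma D01_horner f u : {in I01, f =1 horner u} ->
  {in I01, forall x, derivable01 f x /\ D01 f x = u^`().[x]}.
Proof.
move=> fu x xI; have fc := quot01_horner_cvg xI fu.
split; first by apply/cvg_ex; eexists; exact: fc.
by have ? := within01_proper xI; exact: (cvg_lim _ fc).
Qed.

Lemma C2_01_horner u : C2_01 (horner u).
Proof.
have h0 : {in I01, horner u =1 horner u} by [].
have h1 : {in I01, D01 (horner u) =1 horner u^`()}.
  by move=> x xI; have [] := D01_horner h0 xI.
have h2 : {in I01, horner u^`()^`() =1 D01 (D01 (horner u))}.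
  by move=> x xI; have [] := D01_horner h1 xI.
split.
- move=> x xI; have xI' : x \in I01 by rewrite inE.
  by have [] := D01_horner h0 xI'.
- move=> x xI; have xI' : x \in I01 by rewrite inE.
  by have [] := D01_horner h1 xI'.
- apply: (subspace_eq_continuous h2).
  exact: within_continuous_horner.
Qed.

Lemma PD_horner u : {in I01, PD (horner u) =1 horner (PD_poly u)}.
Proof.
move=> x xI; rewrite /PD /PD_poly.
apply: (proj2 (D01_horner _ xI)) => y yI.
have h0 : {in I01, horner u =1 horner u} by [].
by have [_ ->] := D01_horner h0 yI; rewrite !hornerE.
Qed.

End Derivatives.

(** * The norm of L_p[0,1] *)

Section Norms.
Context {R : realType} (p : R) (p1 : 1 <= p).
Implicit Types (u : {poly R}) (f g : R -> R).
Local Notation mu := (@lebesgue_measure R).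
Local Notation I01 := (`[0, 1]%classic : set R).

Let p1E : (1 <= p%:E)%E. Proof. by rewrite lee_fin. Qed.
Let p0 : 0 < p. Proof. exact: lt_le_trans ltr01 p1. Qed.

Lemma Lp01_measurable f : Lp01 p f -> measurable_fun setT (f \_ I01).
Proof. by rewrite /Lp01 /= => /andP[/[!inE]]. Qed.

Lemma eq_Lp01_norm f g : {in I01, f =1 g} -> Lp01_norm p f = Lp01_norm p g.
Proof.
move=> fg; congr Lnorm; apply/funext => x /=.
by rewrite /patch; case: ifPn => // xI; rewrite fg.
Qed.

Lemma Lp01_normD f g : Lp01 p f -> Lp01 p g ->
  (Lp01_norm p (f \+ g)%R <= Lp01_norm p f + Lp01_norm p g)%E.
Proof.
move=> /Lp01_measurable mf /Lp01_measurable mg; rewrite /Lp01_norm.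
rewrite (_ : (f \+ g)%R \_ I01 = (f \_ I01 \+ g \_ I01)%R).
  exact: eminkowski.
by apply/funext => x /=; rewrite /patch; case: ifP => //; rewrite addr0.
Qed.

Lemma Lp01_normN f : Lp01_norm p (\- f)%R = Lp01_norm p f.
Proof.
rewrite /Lp01_norm -[RHS]oppe_Lnorm; congr Lnorm; apply/funext => x /=.
by rewrite /patch; case: ifP => //; rewrite oppr0.
Qed.

Lemma Lp01_normZ a f : Lp01 p f ->
  Lp01_norm p (a \*: f)%R = (`|a|%:E * Lp01_norm p f)%E.
Proof.
rewrite /Lp01 /= => fL; rewrite /Lp01_norm.
have := LnormZ (Lfun_Sub p1E fL) a; rewrite Lfun_valP => <-.
congr Lnorm; apply/funext => x /=.
by rewrite /patch; case: ifP => //; rewrite scaler0.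
Qed.

Lemma Lp01D a f g : Lp01 p f -> Lp01 p g -> Lp01 p (fun x => a * f x + g x).
Proof.
rewrite /Lp01 /= => fL gL.
rewrite (_ : _ \_ _ = a *: (f \_ I01) + g \_ I01).
  exact: (Lfun_submod_closed mu p1E).2.
apply/funext => x; rewrite -[RHS]/(a * (f \_ I01) x + (g \_ I01) x) /patch.
by case: ifP => // _; rewrite mulr0 addr0.
Qed.

Lemma Lp01_horner u : Lp01 p (horner u).
Proof.
rewrite /Lp01 /=; apply/andP; split; rewrite inE /=.
  apply/(measurable_restrictT (horner u) (measurable_itv `[0, 1])).
  exact: measurable_horner.
rewrite /finite_norm unlock; apply: poweR_lty.
have iu : mu.-integrable I01 (EFin \o (fun x => `|u.[x]| `^ p)).
  apply: measurable_bounded_integrable => //.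
  - by rewrite /= lebesgue_measure_itv /= lte_fin ltr01 -EFinD ltry.
  - apply: (measurableT_comp (measurable_powR _)) => //.
    by apply: measurableT_comp => //; apply: measurable_horner.
  - have [M [Mr MP]] := bounded_horner u.
    exists (`|M + 1| `^ p); split; rewrite ?num_real // => N MN x xI /=.
    rewrite ger0_norm ?powR_ge0 //; apply: le_trans (ltW MN).
    apply: ge0_ler_powR; rewrite ?nnegrE ?normr_ge0 //; first exact: ltW.
    apply: le_trans (ler_norm _); apply: MP => //; lra.
have up : (\int[mu]_(x in I01) (`|u.[x]| `^ p)%:E < +oo)%E.
  exact: integrable_lty.
rewrite integral_mkcond in up; apply: le_lt_trans up.
rewrite le_eqVlt; apply/orP; left; apply/eqP.
apply: eq_integral => x _ /=; rewrite /patch; case: ifP => //= _.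
by rewrite normr0 powR0 // gt_eqF.
Qed.

(** Since p >= 1, |f| is dominated on [0,1] by 1 + |f|^p. *)
Lemma Lp01_integrable f : Lp01 p f -> mu.-integrable I01 (EFin \o f).
Proof.
move=> fL; have mf := Lp01_measurable fL; move: fL; rewrite /Lp01 /= => fL.
have mfI : measurable_fun I01 f.
  by apply/(measurable_restrictT f (measurable_itv `[0, 1])).
have fp : mu.-integrable I01 (fun x => (`|(f \_ I01) x| `^ p)%:E).
  by apply: integrableS (Lfun_integrable p1 fL).
have cfp : mu.-integrable I01 (fun x => (1 + `|(f \_ I01) x| `^ p)%:E).
  rewrite (_ : (fun _ => _) =
    ((EFin \o (fun=> 1%R)) \+ (fun x => (`|(f \_ I01) x| `^ p)%:E))%E) //.
  by apply: integrableD => //; exact: integrable_cst01.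
apply: le_integrable cfp => //.
- exact/measurable_EFinP.
- move=> x xI; rewrite /= lee_fin [leRHS]ger0_norm; last first.
    by rewrite addr_ge0 // powR_ge0.
  rewrite /patch mem_set //.
  have [f1|f1] := leP `|f x| 1; first by rewrite (le_trans f1) // lerDl powR_ge0.
  rewrite (le_trans (_ : _ <= `|f x| `^ p)) ?lerDr //.
  by rewrite -[leLHS]powRr1 // ler_powR // ltW.
Qed.

Lemma Lp01_norm_sum n (d : nat -> R) (F : nat -> {poly R}) (B : \bar R) :
    (forall m, (m < n)%N -> 0 <= d m) ->
    (0 <= B)%E ->
    (forall m, (m < n)%N -> Lp01_norm p (horner (F m)) <= B)%E ->
  (Lp01_norm p (horner (\sum_(m < n) d m *: F m)) <=
     (\sum_(m < n) d m)%:E * B)%E.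
Proof.
move=> d0 B0; elim: n d0 => [|n IH] d0 FB.
  rewrite !big_ord0 mul0e (@eq_Lp01_norm _ (fun=> 0)); last first.
    by move=> x _; rewrite horner0.
  rewrite /Lp01_norm (_ : _ \o _ = cst 0%E) ?Lnorm0 ?eqe ?gt_eqF //.
  by apply/funext => x /=; rewrite /patch; case: ifP.
rewrite !big_ord_recr /=.
rewrite (_ : horner _ =
  horner (\sum_(m < n) d m *: F m) \+ (d n \*: horner (F n))); last first.
  by apply/funext => x; rewrite hornerD hornerZ.
have dn := d0 n (ltnSn n).
have dF : Lp01 p (d n \*: horner (F n))%R.
  rewrite (_ : _ \*: _ = horner (d n *: F n)); first exact: Lp01_horner.
  by apply/funext => x; rewrite hornerZ.
apply: le_trans (Lp01_normD (Lp01_horner _) dF) _.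
rewrite Lp01_normZ; last exact: Lp01_horner.
rewrite EFinD ge0_muleDl ?lee_fin //; last first.
  by apply: sumr_ge0 => m _; apply: d0; exact: leqW (ltn_ord m).
apply: leeD; first by apply: IH => m mn; [apply: d0|apply: FB]; exact: leqW.
by rewrite ger0_norm // lee_wpmul2l ?lee_fin // FB.
Qed.

End Norms.

(** * The lower estimate by the K-functional *)

Theorem proposition1p3 (R : realType) (p : R) (hp : 4 / 3 < p < 4)
    (s : R) (hs : 1 <= s)
    (hS : forall (f : R -> R) (n : nat), Lp01 p f -> (0 < n)%N ->
       (Lp01_norm p (legendre_sum n f) <= s%:E * Lp01_norm p f)%E) :
  forall (f : R -> R) (n : nat), Lp01 p f -> (0 < n)%N ->
    (K_functional p f n%:R^-1
      <= (1 + 2 * s)%:E * Lp01_norm p (bernstein_durrmeyer n f \- f)%R)%E.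
Proof.
move=> f n fL n0.
have p1 : 1 <= p by case/andP: hp => ? _; lra.
pose phi := moment f; pose g := durrmeyer_poly n phi.
have lphi : scalar phi := moment_is_scalar (Lp01_integrable p1 fL).
have gE : bernstein_durrmeyer n f = horner g.
  apply/funext => x; rewrite /g /durrmeyer_poly horner_sum; apply: eq_bigr => k _.
  rewrite hornerZ horner_bernstein_poly [RHS]mulrC -mulrA [X in _ = _ * X]mulrC.
  congr (_ * (_^-1 * _)).
    by rewrite int01E; apply: eq_Rintegral => y _; rewrite horner_bernstein_poly.
  by apply: eq_Rintegral => y _; rewrite horner_bernstein_poly.
rewrite gE; set h := (horner g \- f)%R.
have hL : Lp01 p h.
  rewrite (_ : h = fun x => -1 * f x + horner g x).
    by apply: Lp01D => //; exact: Lp01_horner.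
  by apply/funext => x; rewrite /h /= mulN1r addrC.
have momh v : moment h v = int01 (g * v) - phi v.
  rewrite -moment_horner -RintegralB //.
  - by apply: eq_Rintegral => x _; rewrite mulrBl.
  - by apply: integrable_moment; exact: integrable_horner.
  - by apply: integrable_moment; exact: (Lp01_integrable p1 fL).
pose F m := \sum_(l < m.+2) legendre_coef (moment h) l *: legendre01 l.
have FE m : horner (F m) = legendre_sum m.+1 h.
  apply/funext => x; rewrite horner_sum; apply: eq_bigr => l _.
  by rewrite hornerZ /legendre_coef -moment_horner.
have PDE : PD_poly g =
    \sum_(m < n) (PD_multiplier n m.+1 - PD_multiplier n m.+2) *: F m.
  rewrite PD_poly_durrmeyer //; apply: eq_bigr => m _; congr (_ *: _).
  by apply: eq_bigr => l _; rewrite /legendre_coef momh.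
have N0 : (0 <= Lp01_norm p h)%E by exact: Lnorm_ge0.
have PDbound :
    (Lp01_norm p (PD (horner g)) <= n%:R%:E * (s%:E * Lp01_norm p h))%E.
  rewrite (eq_Lp01_norm _ (@PD_horner R g)) PDE.
  rewrite -(PD_multiplier_telescope (R := R) n0).
  apply: (@Lp01_norm_sum _ _ p1 n
    (fun m => PD_multiplier n m.+1 - PD_multiplier n m.+2)).
  - by move=> m mn; rewrite subr_ge0 PD_multiplier_decreasing.
  - by rewrite mule_ge0 // lee_fin (le_trans ler01).
  - by move=> m mn; rewrite FE hS.
(* M_n f itself is the competitor in the infimum *)
apply: le_trans (_ : _ <= Lp01_norm p (f \- horner g)%R +
    n%:R^-1%:E * Lp01_norm p (PD (horner g)))%E _.
  apply: ereal_inf_lbound; exists (horner g) => //; exact: C2_01_horner.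
rewrite (_ : (f \- horner g)%R = (\- h)%R); last first.
  by apply/funext => x /=; rewrite opprB.
rewrite Lp01_normN.
apply: le_trans (_ : _ <= Lp01_norm p h + s%:E * Lp01_norm p h)%E _.
  apply: leeD => //.
  apply: le_trans (_ : _ <= n%:R^-1%:E * (n%:R%:E * (s%:E * Lp01_norm p h)))%E _.
    by apply: lee_wpmul2l => //; rewrite lee_fin invr_ge0.
  by rewrite muleA -EFinM mulVf ?mul1e // pnatr_eq0 -lt0n.
rewrite -{1}[Lp01_norm p h]mul1e -ge0_muleDl ?lee_fin ?(le_trans ler01) //.
apply: lee_wpmul2r => //; rewrite -EFinD lee_fin; lra.
Qed.
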